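(* The regular octahedron in its standard position in $\mathbb{R}^3$ can be decomposed into two heptahedra (convex polytopes with exactly 7 faces) with orthogonally connected boundaries.
   Context: A polygonal path in $\mathbb{R}^3$ is orthogonal if each of its edges is parallel to one of the coordinate axes. A set $S\subset\mathbb{R}^3$ is orthogonally connected if any two distinct points of $S$ are joined by an orthogonal path contained in $S$. A polytope is decomposed into polytopes $P_1,\dots,P_k$ if it is their union and their interiors are pairwise disjoint. Faces are the 2-dimensional faces. Standard position of the regular octahedron: one of its three diagonals is parallel to the $z$-axis, and the square formed by the four remaining vertices has its sides parallel to the $x$-axis and the $y$-axis. For example, the convex hull of $(\pm1,\pm1,0)$ and $(0,0,\pm\sqrt2)$. *)

(* Defs.v *)
From HB Require Import structures.
From mathcomp Require Import all_boot all_order all_algebra.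
From mathcomp Require Import all_classical all_reals all_analysis.

Set Implicit Arguments.
Unset Strict Implicit.
Unset Printing Implicit Defensive.

Import Order.TTheory GRing.Theory Num.Theory.
Import numFieldNormedType.Exports.

Local Open Scope classical_set_scope.
Local Open Scope ring_scope.

Section Euclidean.
Variables (R : realType) (n : nat).
Implicit Types (A P F : set 'rV[R]_n).

Definition dot (u v : 'rV[R]_n) : R := \sum_(i < n) u 0 i * v 0 i.

Definition conv A : set 'rV[R]_n := smallest (@convex_set R 'rV[R]_n) A.

Definition segment (p q : 'rV[R]_n) : set 'rV[R]_n :=
  [set (1 - t) *: p + t *: q | t in `[0, 1]].

Definition boundary A : set 'rV[R]_n := closure A `\` interior A.

(* [k.+1] affinely independent points: the differences with the first one are
   linearly independent. *)
Definition has_indep_points (k : nat) A : Prop :=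
  exists p : 'I_k.+1 -> 'rV[R]_n,
    (forall i, A (p i)) /\
    row_free (\matrix_(i < k) (p (lift ord0 i) - p ord0)).

Definition affine_dim (k : nat) A : Prop :=
  has_indep_points k A /\ ~ has_indep_points k.+1 A.

Definition convex_polytope P : Prop :=
  exists2 V : set 'rV[R]_n, finite_set V & P = conv V.

(* The normal [a] may be zero, so [P] itself and [set0] are faces. *)
Definition face P F : Prop :=
  exists (a : 'rV[R]_n) (b : R),
    (forall x, P x -> dot a x <= b) /\ F = P `&` [set x | dot a x = b].

Definition decomposed_into (k : nat) P (Q : 'I_k -> set 'rV[R]_n) : Prop :=
  P = \bigcup_i Q i /\
  forall i j, i != j -> interior (Q i) `&` interior (Q j) = set0.

Definition parallel_to_axis (i : 'I_n) (v : 'rV[R]_n) : Prop :=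
  exists2 t : R, t != 0 & v = t *: delta_mx 0 i.

(* The vertices of the path are [p 0], ..., [p m]. *)
Definition orthogonal_path_in A (x y : 'rV[R]_n) : Prop :=
  exists (m : nat) (p : nat -> 'rV[R]_n),
    [/\ p 0%N = x, p m = y &
        forall k, (k < m)%N ->
          (exists i, parallel_to_axis i (p k.+1 - p k)) /\
          segment (p k) (p k.+1) `<=` A].

Definition orthogonally_connected A : Prop :=
  forall x y, A x -> A y -> x <> y -> orthogonal_path_in A x y.

End Euclidean.

Section Space.
Variable R : realType.
Implicit Types (c u v w : 'rV[R]_3) (P O : set 'rV[R]_3).

Definition x_axis : 'I_3 := 0.
Definition y_axis : 'I_3 := 1.
Definition z_axis : 'I_3 := ord_max.

Definition heptahedron P : Prop :=
  [/\ convex_polytope P, affine_dim 3 P &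
      ([set F | face P F /\ affine_dim 2 F] #= `I_7)%card].

(* A regular octahedron has centre [c] and half-diagonals [u], [v], [w]. *)
Definition regular_octahedron c u v w O : Prop :=
  [/\ [/\ dot u v = 0, dot u w = 0 & dot v w = 0],
      dot u u = dot v v /\ dot u u = dot w w, u != 0 &
      O = conv [set c + u; c - u; c + v; c - v; c + w; c - w]].

Definition parallel_to_x_or_y v : Prop :=
  parallel_to_axis x_axis v \/ parallel_to_axis y_axis v.

(* Up to sign, the sides of the square with vertices [c + u], [c + v],
   [c - u], [c - v] are [u - v] and [u + v]. *)
Definition standard_octahedron O : Prop :=
  exists c u v w,
    [/\ regular_octahedron c u v w O, parallel_to_axis z_axis w,
        parallel_to_x_or_y (u - v) & parallel_to_x_or_y (u + v)].

Definition vec3 (x y z : R) : 'rV[R]_3 := \row_i [:: x; y; z]`_i.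

Lemma standard_octahedron_example :
  standard_octahedron
    (conv [set vec3 1 1 0; vec3 (-1) (-1) 0; vec3 1 (-1) 0; vec3 (-1) 1 0;
               vec3 0 0 (Num.sqrt 2); vec3 0 0 (- Num.sqrt 2)]).
Proof.
exists 0, (vec3 1 1 0), (vec3 1 (-1) 0), (vec3 0 0 (Num.sqrt 2)).
have s2 : Num.sqrt 2 * Num.sqrt 2 = 2 :> R by rewrite -expr2 sqr_sqrtr.
have vecN x y z : - vec3 x y z = vec3 (- x) (- y) (- z).
  by apply/rowP => -[[|[|[|//]]] ?]; rewrite !mxE.
split.
- split.
  + by split; rewrite /dot !big_ord_recl !big_ord0 !mxE /=
      ?(mulr0, mul0r, mulr1, mul1r, addr0, add0r, subrr).
  + by split; rewrite /dot !big_ord_recl !big_ord0 !mxE /=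
      ?(s2, mulrNN, mulr0, mul0r, mulr1, mul1r, addr0, add0r).
  + by apply/eqP => /rowP/(_ 0); rewrite !mxE /=; apply/eqP; rewrite oner_eq0.
  + by rewrite !add0r !vecN !oppr0 opprK.
- exists (Num.sqrt 2); first by rewrite sqrtr_eq0 -ltNge.
  by apply/rowP => -[[|[|[|//]]] ?]; rewrite !mxE /= ?(mulr0, mulr1).
- right; exists 2; first by rewrite pnatr_eq0.
  by apply/rowP => -[[|[|[|//]]] ?]; rewrite !mxE /= 
    ?(mulr0, mulr1, subrr, opprK).
- left; exists 2; first by rewrite pnatr_eq0.
  by apply/rowP => -[[|[|[|//]]] ?]; rewrite !mxE /= 
    ?(mulr0, mulr1, subrr, addr0).
Qed.

End Space.

(* Main.v *)
Require Import Defs.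
From mathcomp Require Import all_boot all_order all_algebra.
From mathcomp Require Import all_classical all_reals all_analysis.
From mathcomp Require Import ring lra.

(** In suitable axis-parallel coordinates (x, y, z) the octahedron is
[|x| + |z| <= 1, |y| + |z| <= 1].  A lateral face contains segments in only one
axis direction, so on its boundary no orthogonal path can change the height z.
The cut by the plane y = 0, which passes through both apexes, repairs this.

- The half y >= 0 is bounded by the section y = 0, by the two faces
  y + z = 1 and y - z = 1, and by halves of the four faces x + z = 1,
  x - z = 1, - x + z = 1, - x - z = 1: seven faces.
- The section is the square |x| + |z| <= 1 of the xz-plane, which contains
  both the x- and the z-direction and whose diagonals are parallel to the axes;
  every point of it reaches the centre of the octahedron by a vertical and then
  a horizontal move.  On a face with |x| + |z| = 1 the y-direction leads to the
  section, and on a face with y + |z| = 1 the x-direction leads to a face of the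
  former kind.  So every boundary point is joined to the centre.

The other half is the same set with the y-axis reversed, so everything is proved
for one set, in coordinates whose scale factors may be negative.

That there are exactly seven faces is an instance of a general fact
([card_facets]): if a polyhedron given by k inequalities with nonzero normals
has a strictly interior point, and if for each inequality some point is tight
for it and strict for the others, then its faces of codimension one are exactly
the k sets cut out by the inequalities.  The same description by inequalities
gives the boundary ([boundary_polyhedron]).  That the octahedron and its halves
are convex hulls of their vertices is [conv_bipyramid]. *)

Set Implicit Arguments.
Unset Strict Implicit.
Unset Printing Implicit Defensive.

Import Order.TTheory GRing.Theory Num.Theory.
Import numFieldNormedType.Exports.

Local Open Scope classical_set_scope.
Local Open Scope ring_scope.

(** * The scalar product *)

Section Dot.
Variables (R : realType) (n : nat).
Implicit Types u v w : 'rV[R]_n.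

Lemma dot_mulmx u v : dot u v = (u *m v^T) 0 0.
Proof. by rewrite mxE; apply: eq_bigr => i _; rewrite mxE. Qed.

Lemma dotC u v : dot u v = dot v u.
Proof. by apply: eq_bigr => i _; rewrite mulrC. Qed.

Lemma dotDr u v w : dot u (v + w) = dot u v + dot u w.
Proof. by rewrite !dot_mulmx linearD mulmxDr mxE. Qed.

Lemma dotZr (t : R) u v : dot u (t *: v) = t * dot u v.
Proof. by rewrite !dot_mulmx linearZ /= -scalemxAr mxE. Qed.

Lemma dotBr u v w : dot u (v - w) = dot u v - dot u w.
Proof. by rewrite dotDr -scaleN1r dotZr mulN1r. Qed.

Lemma dotZl (t : R) u v : dot (t *: u) v = t * dot u v.
Proof. by rewrite dotC dotZr dotC. Qed.

Lemma dot_sumr (I : finType) u (p : I -> 'rV[R]_n) :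
  dot u (\sum_i p i) = \sum_i dot u (p i).
Proof.
rewrite dot_mulmx linear_sum mulmx_sumr summxE.
by apply: eq_bigr => i _; rewrite dot_mulmx.
Qed.

Lemma dot_gt0 u : u != 0 -> 0 < dot u u.
Proof.
move=> u0; rewrite lt_neqAle sumr_ge0 ?andbT => [|i _]; last first.
  by rewrite -expr2 sqr_ge0.
apply: contra u0; rewrite eq_sym => /eqP u0; apply/eqP/rowP => i.
apply/eqP; rewrite mxE -sqrf_eq0 expr2.
rewrite (psumr_eq0P _ u0) => // j _; by rewrite -expr2 sqr_ge0.
Qed.

Lemma mulmx_tr_eq0 k (M : 'M[R]_(k, n)) u :
  (forall j, dot u (row j M) = 0) -> M *m u^T = 0.
Proof.
move=> Mu; apply/matrixP => j l; rewrite (ord1 l) [RHS]mxE -(Mu j) mxE.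
by apply: eq_bigr => i _; rewrite !mxE mulrC.
Qed.

Lemma dot_row_eq0 k (M : 'M[R]_(k, n)) u :
  M *m u^T = 0 -> forall j, dot u (row j M) = 0.
Proof.
move=> Mu j; rewrite dotC dot_mulmx -row_mul Mu.
by rewrite !mxE.
Qed.
End Dot.

(** * Affine independence *)

Lemma small_pos_ex (R : realType) (Q : set R) :
  (\forall t \near 0^'+, Q t) -> exists2 t, 0 < t & Q t.
Proof.
move=> nQ; have [t [t0 Qt]] := filter_ex (filterI (nbhs_right_gt (0 : R)) nQ).
by exists t.
Qed.

Section AffineDimension.
Variables (R : realType) (n : nat).
Implicit Types (A : set 'rV[R]_n.+1) (u v x : 'rV[R]_n.+1).

Lemma nbhs_ray A x v : nbhs x A -> \forall t \near 0^'+, A (x + t *: v).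
Proof.
have : (fun t : R => x + t *: v) @ 0^'+ --> x.
  apply: cvg_at_right_filter.
  rewrite -[in X in _ --> X](addr0 x) -[in X in _ --> X](scale0r v).
  by apply: cvgD; [exact: cvg_cst|apply: cvgZr_tmp; exact: cvg_id].
exact.
Qed.

(** A point together with short steps from it along independent directions is
affinely independent; so having room in these directions bounds the dimension
of [A] from below. *)
Lemma has_indep_points_rays k A x (M : 'M[R]_(k, n.+1)) :
  A x -> row_free M ->
  (forall j, \forall t \near 0^'+, A (x + t *: row j M)) ->
  has_indep_points k A.
Proof.
move=> Ax fM AM.
have [t t0 At] := small_pos_ex (filter_forall _ AM).
exists (fun i => if unlift ord0 i is Some j then x + t *: row j M else x).
split; first by move=> i; case: unliftP.
rewrite (_ : \matrix_(i < k) _ = t *: M).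
  by rewrite /row_free mxrank_scale_nz ?(gt_eqF t0).
apply/row_matrixP => i; rewrite rowK linearZ liftK unlift_none /=.
by rewrite addrC addKr.
Qed.

Lemma indep_points_le k A : has_indep_points k A -> (k <= n.+1)%N.
Proof.
move=> [p [_ /eqP <-]]; exact: rank_leq_col.
Qed.

Lemma indep_points_hyperplane k A u b : u != 0 ->
  A `<=` [set x | dot u x = b] -> has_indep_points k A -> (k <= n)%N.
Proof.
move=> u0 Au [p [Ap /eqP fp]].
set M := \matrix_i _ in fp.
have : M *m u^T = 0.
  apply: mulmx_tr_eq0 => j; rewrite rowK dotBr.
  by rewrite (Au _ (Ap _)) (Au _ (Ap _)) subrr.
move=> /mulmx0_rank_max; rewrite fp.
by rewrite mxrank_tr rank_rV u0 addn1 ltnS.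
Qed.

(** The hyperplane through the points is unique: the vectors orthogonal to all
differences form a space of dimension [n.+1 - n = 1]. *)
Lemma indep_points_normal (p : 'I_n.+1 -> 'rV[R]_n.+1) u b v c :
  row_free (\matrix_(i < n) (p (lift ord0 i) - p ord0)) -> u != 0 ->
  (forall l, dot u (p l) = b) -> (forall l, dot v (p l) = c) ->
  exists t, v = t *: u.
Proof.
move=> /eqP fp u0 pu pv; set M := \matrix_i _ in fp.
have kerM w d : (forall l, dot w (p l) = d) -> (w <= kermx M^T)%MS.
  move=> pw; apply/sub_kermxP; apply: trmx_inj; rewrite trmx_mul trmxK trmx0.
  by apply: mulmx_tr_eq0 => j; rewrite rowK dotBr !pw subrr.
have uK := kerM _ _ pu; have vK := kerM _ _ pv.
have rK : \rank (kermx M^T) = 1%N.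
  by rewrite mxrank_ker mxrank_tr fp subSn // subnn.
have Ku : (kermx M^T <= u)%MS.
  by rewrite -(mxrank_leqif_sup uK) rK rank_rV u0.
by have /sub_rVP := submx_trans vK Ku.
Qed.
End AffineDimension.

(** * Facets of a polyhedron given by inequalities *)

Section Polyhedron.
Variables (R : realType) (n k : nat).
Variables (N : 'I_k -> 'rV[R]_n.+1) (B : 'I_k -> R).
Implicit Types (x v : 'rV[R]_n.+1).

Definition polyhedron : set 'rV[R]_n.+1 :=
  [set x | forall i, dot (N i) x <= B i].

Definition facet i : set 'rV[R]_n.+1 :=
  polyhedron `&` [set x | dot (N i) x = B i].

Lemma dot_continuous (u : 'rV[R]_n.+1) : continuous (dot u).
Proof.
move=> x; apply: (@cvg_big R _ _ _ _ (@add_continuous R) _ (nbhs x) _ _ _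
  (nbhs_filter x)).
move=> i _; apply: cvgM; [exact: cvg_cst|exact: coord_continuous].
Qed.

Lemma polyhedron_closed : closed polyhedron.
Proof.
rewrite (_ : polyhedron = \bigcap_i (dot (N i) @^-1` [set y | y <= B i])).
  apply: closed_bigI => i _.
  apply: preimage_closed; last exact: closed_le.
  by move=> x _; exact: dot_continuous.
by apply/seteqP; split => [x Px i _|x Px i]; exact: Px.
Qed.

Lemma near_strict i x : dot (N i) x < B i -> \forall y \near x, dot (N i) y < B i.
Proof.
move=> xi; apply: (@dot_continuous (N i) x (fun y => y < B i)).
exact: lt_nbhsl.
Qed.

Lemma strict_nbhs x : (forall i, dot (N i) x < B i) -> nbhs x polyhedron.
Proof.
move=> xB; have : \forall y \near x, forall i, dot (N i) y < B i.
  by apply: (filter_forall (nbhs_filter x)) => i; exact: near_strict.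
by apply: filterS => y yB i; exact/ltW.
Qed.

Hypothesis N0 : forall i, N i != 0.

(** From a point with [dot (N i) x = B i], any step along [N i] leaves. *)
Lemma interior_polyhedron :
  interior polyhedron = [set x | forall i, dot (N i) x < B i].
Proof.
apply/seteqP; split => [x Px i|x]; last exact: strict_nbhs.
have [t t0 /(_ i)] := small_pos_ex (nbhs_ray (N i) Px).
rewrite dotDr dotZr; apply: lt_le_trans.
by rewrite ltrDl mulr_gt0 // dot_gt0.
Qed.

Lemma boundary_polyhedron : boundary polyhedron = \bigcup_i facet i.
Proof.
rewrite /boundary interior_polyhedron.
rewrite -(proj1 (closure_id _) polyhedron_closed).
apply/seteqP; split => [x [Px]|x [i _ [Px xi]]].
  move=> /existsNP[i] /negP; rewrite -leNgt => xi.
  by exists i => //; split => //; apply/eqP; rewrite eq_le Px.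
by split => // /(_ i); rewrite xi ltxx.
Qed.

(* The existence of the points [m i] ensures that no inequality is redundant. *)
Variable (c : 'rV[R]_n.+1) (m : 'I_k -> 'rV[R]_n.+1).
Hypothesis c_int : forall i, dot (N i) c < B i.
Hypothesis m_on : forall i, dot (N i) (m i) = B i.
Hypothesis m_off : forall i j, j != i -> dot (N j) (m i) < B j.

Lemma affine_dim_polyhedron : affine_dim n.+1 polyhedron.
Proof.
split; last by move=> /indep_points_le; rewrite ltnn.
have Pc := strict_nbhs c_int.
apply: (@has_indep_points_rays _ _ _ _ c 1%:M).
- exact: nbhs_singleton.
- by rewrite row_free_unit unitmx1.
- by move=> j; exact: nbhs_ray.
Qed.

Lemma facet_witness i : facet i (m i).
Proof.
split; last exact: m_on.
move=> j; have [->|ji] := eqVneq j i; first by rewrite m_on.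
exact/ltW/m_off.
Qed.

(** Near [m i] only the inequality [i] is a constraint, so one can move from
[m i] in every direction orthogonal to [N i]. *)
Lemma affine_dim_facet i : affine_dim n (facet i).
Proof.
split; last first.
  have Fi : facet i `<=` [set x | dot (N i) x = B i] by move=> x [].
  by move=> /(indep_points_hyperplane (N0 i) Fi); rewrite ltnn.
have r : \rank (kermx (N i)^T) = n.
  by rewrite mxrank_ker mxrank_tr rank_rV N0 subn1.
rewrite -[X in has_indep_points X _]r.
apply: (@has_indep_points_rays _ _ _ _ (m i) (row_base (kermx (N i)^T))).
- exact: facet_witness.
- exact: row_base_free.
- move=> j; set v := row j _.
  have vi : dot (N i) v = 0.
    by apply: dot_row_eq0; apply/sub_kermxP; rewrite eq_row_base.
  have line t : dot (N i) (m i + t *: v) = B i.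
    by rewrite dotDr dotZr vi mulr0 addr0 m_on.
  have : \forall t \near (0:R)^'+, forall l, dot (N l) (m i + t *: v) <= B l.
    apply: (filter_forall (at_right_proper_filter 0)) => l.
    have [->|li] := eqVneq l i.
      by apply: nearW => t; rewrite line.
    have := nbhs_ray v (near_strict (m_off li)).
    by apply: filterS => t /= /ltW.
  by apply: filterS => t; split; [|exact: line].
Qed.

Lemma face_facet i : face polyhedron (facet i).
Proof. by exists (N i), (B i); split. Qed.

Lemma facet_inj : injective facet.
Proof.
move=> i j ij; apply/eqP/negPn/negP => nij.
have := facet_witness i; rewrite ij => -[_ /= ji].
by have := m_off (i := i) (j := j); rewrite eq_sym ji ltxx => /(_ nij).
Qed.

(** An average of numbers at most [B i] equals [B i] only if all of them do. *)
Lemma tight_centroid d (p : 'I_d.+1 -> 'rV[R]_n.+1) i :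
  (forall l, polyhedron (p l)) ->
  dot (N i) (d.+1%:R^-1 *: \sum_l p l) = B i ->
  forall l, dot (N i) (p l) = B i.
Proof.
move=> Pp; rewrite dotZr dot_sumr => /(congr1 ( *%R d.+1%:R)).
rewrite mulrA divff ?pnatr_eq0 // mul1r => E l.
have : \sum_l (B i - dot (N i) (p l)) = 0.
  by rewrite sumrB E sumr_const card_ord mulr_natl subrr.
move=> /psumr_eq0P H; apply/esym/subr0_eq; apply: H => // j _.
by rewrite subr_ge0 Pp.
Qed.

Lemma polyhedron_centroid d (p : 'I_d.+1 -> 'rV[R]_n.+1) :
  (forall l, polyhedron (p l)) -> polyhedron (d.+1%:R^-1 *: \sum_l p l).
Proof.
move=> Pp i; rewrite dotZr dot_sumr ler_pdivrMl ?ltr0n //.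
rewrite mulr_natl -[d.+1 in leRHS]card_ord -sumr_const.
by apply: ler_sum => l _; exact: Pp.
Qed.

(** Take affinely independent points of the face.  Their centroid lies on the
supporting hyperplane, so it is not interior and is tight for some inequality
[i]; then all the points are tight for [i].  Hence they span both the supporting
hyperplane and that of [i], and the two normals are proportional.  The interior
point [c] makes the factor positive. *)
Lemma facet_face F : face polyhedron F -> affine_dim n F ->
  exists i, F = facet i.
Proof.
move=> [a [b [Pab FE]]] [Fn nFn].
(* With [a = 0] the face is empty or the whole polyhedron. *)
have a0 : a != 0.
  apply/eqP => a0; apply: nFn.
  have [bE|bN] := eqVneq b 0.
    rewrite FE (_ : _ `&` _ = polyhedron); first exact: affine_dim_polyhedron.1.
    apply/setIidl => x _ /=; rewrite a0 bE.
    by rewrite -(scale0r 0) dotZl mul0r.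
  case: Fn => p [/(_ ord0)]; rewrite FE => -[_ /=].
  by rewrite a0 -(scale0r 0) dotZl mul0r => /esym/eqP; rewrite (negbTE bN).
have [p [Fp fp]] := Fn.
have Pp l : polyhedron (p l) by have := Fp l; rewrite FE => -[].
have ap l : dot a (p l) = b by have := Fp l; rewrite FE => -[].
set q := n.+1%:R^-1 *: \sum_l p l.
have aq : dot a q = b.
  rewrite dotZr dot_sumr (eq_bigr (fun=> b)) // sumr_const card_ord.
  by rewrite -[b *+ _]mulr_natl mulrA mulVf ?mul1r // pnatr_eq0.
have [i qi] : exists i, dot (N i) q = B i.
  apply: contrapT => /forallNP nq.
  have : nbhs q polyhedron.
    apply: strict_nbhs => i; rewrite lt_neqAle polyhedron_centroid // andbT.
    exact/eqP/nq.
  move=> /(nbhs_ray a) /small_pos_ex[t t0 /Pab].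
  rewrite dotDr dotZr aq.
  by rewrite gerDl leNgt mulr_gt0 // dot_gt0.
have Ni l : dot (N i) (p l) = B i by exact: tight_centroid qi l.
have [t aE] := indep_points_normal fp (N0 i) Ni ap.
have bE : b = t * B i by rewrite -aq aE dotZl qi.
have t0 : 0 < t.
  have := Pab c (fun j => ltW (c_int j)); rewrite aE bE dotZl => ct.
  have tN0 : t != 0 by apply: contraNneq a0 => t0; rewrite aE t0 scale0r.
  by rewrite lt_neqAle eq_sym tN0 leNgt; apply: contraTN ct => t0;
    rewrite -ltNge ltr_nM2l.
exists i; rewrite FE /facet; congr (_ `&` _).
apply/predeqP => x /=; rewrite aE bE dotZl; split => [|->//].
by move=> /mulfI; apply; rewrite gt_eqF.
Qed.

Lemma card_facets :
  ([set F | face polyhedron F /\ affine_dim n F] #= `I_k)%card.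
Proof.
rewrite (_ : [set F | _] = [set facet i | i in setT]).
  apply: card_eq_trans (card_esym card_II).
  by apply: inj_card_eq => i j _ _; exact: facet_inj.
apply/seteqP; split => [F [PF dF]|_ [i _ <-]].
  by have [i ->] := facet_face PF dF; exists i.
by split; [exact: face_facet|exact: affine_dim_facet].
Qed.
End Polyhedron.

(** * Convex sets *)

Lemma convex_setP (R : realType) (n : nat) (A : set 'rV[R]_n) :
  @convex_set R 'rV[R]_n A <->
  forall x y t, 0 <= t <= 1 -> A x -> A y -> A ((1 - t) *: x + t *: y).
Proof.
split=> [cA x y t /andP[t0 t1] Ax Ay|cA x y t].
  have := cA y x (Itv01 t0 t1); rewrite !inE => /(_ Ay Ax).
  by rewrite addrC.
rewrite !inE => Ax Ay; have := cA y x t%:num; rewrite addrC; apply => //.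
by rewrite ge0 le1.
Qed.

(** * Orthogonal paths *)

Section OrthogonalPath.
Variables (R : realType) (n : nat).
Implicit Types (A : set 'rV[R]_n) (p q x y z : 'rV[R]_n).

Lemma segmentC p q : segment p q `<=` segment q p.
Proof.
move=> _ [t /= /[!in_itv]/= /andP[t0 t1] <-]; exists (1 - t).
  by rewrite /= in_itv /=; lra.
by rewrite subKr addrC.
Qed.

Lemma orthogonal_path_refl A x : orthogonal_path_in A x x.
Proof. by exists 0%N, (fun=> x). Qed.

(** A degenerate edge ([t = 0]) is covered by the path without edges; this spares
case distinctions when sliding along an axis. *)
Lemma orthogonal_path_edge A x y i (t : R) : y - x = t *: delta_mx 0 i ->
  segment x y `<=` A -> orthogonal_path_in A x y.
Proof.
move=> yx sA; have [t0|t0] := eqVneq t 0.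
  rewrite (_ : y = x); first exact: orthogonal_path_refl.
  by apply/eqP; rewrite -subr_eq0 yx t0 scale0r.
exists 1%N, (fun k => if k is 0%N then x else y); split => // -[|//] _.
by split => //; exists i, t.
Qed.

Lemma orthogonal_path_sym A x y :
  orthogonal_path_in A x y -> orthogonal_path_in A y x.
Proof.
move=> [m [p [p0 pm pA]]]; exists m, (fun k => p (m - k)%N).
split; rewrite ?subn0 ?subnn // => k km.
have /pA[[i [t t0 e]] sA] : (m - k.+1 < m)%N.
  by rewrite ltn_subrL (leq_ltn_trans _ km).
rewrite subnSK // in e sA; split; last by move=> z /segmentC/sA.
by exists i, (- t); rewrite ?oppr_eq0 // scaleNr -e opprB.
Qed.

Lemma orthogonal_path_trans A x y z : orthogonal_path_in A x y ->
  orthogonal_path_in A y z -> orthogonal_path_in A x z.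
Proof.
move=> [m [p [p0 pm pA]]] [l [q [q0 ql qA]]].
exists (m + l)%N, (fun k => if (k <= m)%N then p k else q (k - m)%N).
split => //.
  case: leqP => [|_]; last by rewrite addKn.
  by rewrite -[leqRHS]addn0 leq_add2l leqn0 => /eqP l0; rewrite -ql l0 addn0 q0.
move=> k kml; have [km|mk|km] := ltngtP k m.
- exact: pA.
- by rewrite subSn ?(ltnW mk) //; apply: qA; rewrite ltn_subLR // ltnW.
- subst k; rewrite subSnn pm -q0; apply: qA.
  by move: kml; rewrite -[X in (X < _)%N]addn0 ltn_add2l.
Qed.
End OrthogonalPath.

(** * Axis-parallel coordinates *)

Section Frame.
Variable (R : realType).

Lemma dot_vec3 (x y z x' y' z' : R) :
  dot (vec3 x y z) (vec3 x' y' z') = x * x' + y * y' + z * z'.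
Proof.
by rewrite /dot !big_ord_recl big_ord0 !mxE /= addr0 addrA.
Qed.

Lemma vec3_eta (p : 'rV[R]_3) : p = vec3 (p 0 0) (p 0 1) (p 0 ord_max).
Proof.
by apply/rowP => -[[|[|[|//]]] ?]; rewrite mxE /=; congr (p _ _); exact: val_inj.
Qed.

Variables (c : 'rV[R]_3) (a b h : R).

(** The point with coordinates [x], [y], [z] for the origin [c] and the scale
factors [a], [b], [h] of the axes. *)
Definition frame x y z := c + vec3 (a * x) (b * y) (h * z).

Lemma frame_conv t x y z x' y' z' :
  (1 - t) *: frame x y z + t *: frame x' y' z' =
  frame ((1 - t) * x + t * x') ((1 - t) * y + t * y') ((1 - t) * z + t * z').
Proof. by apply/rowP => -[[|[|[|//]]] ?]; rewrite !mxE /=; ring. Qed.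

Hypotheses (a0 : a != 0) (b0 : b != 0) (h0 : h != 0).

Lemma frame_surj p : exists x y z, p = frame x y z.
Proof.
exists ((p - c) 0 0 / a), ((p - c) 0 1 / b), ((p - c) 0 ord_max / h).
rewrite /frame ![_ * (_ / _)]mulrC !divfK // -vec3_eta.
by rewrite addrC subrK.
Qed.

End Frame.

(** * Bipyramids *)

Section Bipyramid.
Variables (R : realType) (c : 'rV[R]_3) (a b h : R).
Hypotheses (a0 : a != 0) (b0 : b != 0) (h0 : h != 0).
Let pt := frame c a b h.

(** For [s <= 0], the bipyramid over the rectangle [-1 <= x <= 1], [s <= y <= 1]
with the apexes [(0, 0, 1)] and [(0, 0, -1)].  It is the octahedron for [s = -1]
and its half [y >= 0] for [s = 0]; the sign of [s] makes the last condition
convex. *)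
Definition in_bipyramid (s x y z : R) : Prop :=
  [/\ `|x| + `|z| <= 1, y + `|z| <= 1 & s * (1 - `|z|) <= y].

Definition bipyramid s : set 'rV[R]_3 :=
  [set p | exists x y z, p = frame c a b h x y z /\ in_bipyramid s x y z].

Definition bipyramid_vertices s : set 'rV[R]_3 :=
  [set frame c a b h 1 s 0; frame c a b h (-1) s 0; frame c a b h 1 1 0;
       frame c a b h (-1) 1 0; frame c a b h 0 0 1; frame c a b h 0 0 (-1)].

Lemma frame_inj x y z x' y' z' :
  frame c a b h x y z = frame c a b h x' y' z' -> [/\ x = x', y = y' & z = z'].
Proof.
move=> /addrI /rowP e; split.
- by have := e 0; rewrite !mxE /= => /(mulfI a0).
- by have := e 1; rewrite !mxE /= => /(mulfI b0).
- by have := e ord_max; rewrite !mxE /= => /(mulfI h0).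
Qed.

Lemma bipyramidP s x y z :
  bipyramid s (frame c a b h x y z) <-> in_bipyramid s x y z.
Proof.
split=> [[x' [y' [z' [/frame_inj[-> -> ->]]]]]//|]; by exists x, y, z.
Qed.

Lemma conv_le_bound (t x y B : R) : 0 <= t <= 1 -> x <= B -> y <= B ->
  (1 - t) * x + t * y <= B.
Proof. nra. Qed.

Lemma norm_conv (t x y : R) : 0 <= t <= 1 ->
  `|(1 - t) * x + t * y| <= (1 - t) * `|x| + t * `|y|.
Proof.
move=> /andP[t0 t1]; apply: le_trans (ler_normD _ _) _.
by rewrite !normrM (ger0_norm t0) (ger0_norm (_ : 0 <= 1 - t)) ?subr_ge0.
Qed.

Lemma convex_bipyramid s : s <= 0 -> @convex_set R 'rV[R]_3 (bipyramid s).
Proof.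
move=> s0; apply/convex_setP => p q t t01.
move=> [x [y [z [-> [H1 H2 H3]]]]] [x' [y' [z' [-> [H1' H2' H3']]]]].
rewrite frame_conv; apply/bipyramidP.
have nx := norm_conv x x' t01; have nz := norm_conv z z' t01.
split.
- have := conv_le_bound t01 H1 H1'; lra.
- have := conv_le_bound t01 H2 H2'; lra.
- have L3 : s * (1 - `|z|) - y <= 0 by lra.
  have L3' : s * (1 - `|z'|) - y' <= 0 by lra.
  have := conv_le_bound t01 L3 L3'.
  have : s * ((1 - t) * `|z| + t * `|z'| - `|(1 - t) * z + t * z'|) <= 0.
    by rewrite mulr_le0_ge0 // subr_ge0.
  lra.
Qed.

Lemma between_conv (x1 x2 x : R) : x1 <= x <= x2 ->
  exists2 t, 0 <= t <= 1 & x = (1 - t) * x1 + t * x2.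
Proof.
move=> /andP[x1x xx2]; have [e|n] := eqVneq x1 x2.
  exists 0; lra.
have d : 0 < x2 - x1 by rewrite subr_gt0 lt_neqAle n (le_trans x1x).
exists ((x - x1) / (x2 - x1)); last by field; rewrite gt_eqF.
by rewrite divr_ge0 ?ler_pdivrMr //; lra.
Qed.

(** The horizontal slice at height [z] is the base scaled by [r = 1 - |z|].  Its
corners lie on segments from an apex to a corner of the base, its sides parallel
to the y-axis join corners, and the slice is swept by segments in the
x-direction between these sides. *)
Lemma bipyramid_sub_convex s (C : set 'rV[R]_3) : s <= 0 ->
  @convex_set R 'rV[R]_3 C -> bipyramid_vertices s `<=` C ->
  bipyramid s `<=` C.
Proof.
move=> s0 /convex_setP cC VC.
have along x x' y y' z z' u t : 0 <= t <= 1 -> C (pt x y z) -> C (pt x' y' z') ->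
    u = pt ((1 - t) * x + t * x') ((1 - t) * y + t * y') ((1 - t) * z + t * z') ->
    C u.
  by move=> t01 Cx Cy ->; rewrite /pt -frame_conv; exact: cC.
have apex : C (pt 0 0 1) /\ C (pt 0 0 (-1)).
  by split; apply: VC; [left; right|right].
have edge x y z : `|z| <= 1 -> C (pt x y 0) ->
    C (pt (x * (1 - `|z|)) (y * (1 - `|z|)) z).
  move=> z1 Cxy; have z01 : 0 <= `|z| <= 1 by rewrite normr_ge0.
  have [z0|z0] := ger0P z.
  - rewrite (ger0_norm z0) in z01.
    apply: (along _ _ _ _ _ _ _ _ z01 Cxy apex.1).
    by congr (frame _ _ _ _ _ _ _); ring.
  - rewrite (ltr0_norm z0) in z01.
    apply: (along _ _ _ _ _ _ _ _ z01 Cxy apex.2).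
    by congr (frame _ _ _ _ _ _ _); ring.
move=> _ [x [y [z [-> [H1 H2 H3]]]]].
have z1 : `|z| <= 1 by have := normr_ge0 x; lra.
set r := 1 - `|z|.
have side e : C (pt e s 0) -> C (pt e 1 0) -> C (pt (e * r) y z).
  move=> /(edge _ _ _ z1) C1 /(edge _ _ _ z1) C2.
  have [|t t01 yE] := @between_conv (s * r) (1 * r) y; first by rewrite /r; lra.
  apply: (along _ _ _ _ _ _ _ _ t01 C1 C2).
  by congr (frame _ _ _ _ _ _ _) => //; rewrite /r; ring.
have Cl : C (pt (-1 * r) y z).
  by apply: side; apply: VC; [do 4 left; right|do 2 left; right].
have Cr : C (pt (1 * r) y z).
  by apply: side; apply: VC; [do 5 left|do 3 left; right].
have [|t t01 xE] := @between_conv (-1 * r) (1 * r) x.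
  have := ler_norm x; have := ler_norm (- x); rewrite normrN /r; lra.
apply: (along _ _ _ _ _ _ _ _ t01 Cl Cr).
by congr (frame _ _ _ _ _ _ _) => //; ring.
Qed.

Lemma conv_bipyramid s : s <= 0 -> bipyramid s = Defs.conv (bipyramid_vertices s).
Proof.
move=> s0; apply/seteqP; split.
  by move=> p Bp C [cC VC]; exact: (bipyramid_sub_convex s0 cC VC).
apply: smallest_sub; first exact: convex_bipyramid.
have n1 : `|1| = 1 :> R := normr1 R.
have nN1 : `|-1| = 1 :> R by rewrite normrN1.
have n0 : `|0| = 0 :> R := normr0 R.
by move=> _ [[[[[]|]|]|]|] ->; apply/bipyramidP;
  rewrite /in_bipyramid ?(n1, nN1, n0); split; lra.
Qed.

Lemma bipyramid_polytope s : s <= 0 -> convex_polytope (bipyramid s).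
Proof.
move=> s0; exists (bipyramid_vertices s); last exact: conv_bipyramid.
by rewrite !finite_setU; do !split; exact: finite_set1.
Qed.
End Bipyramid.

(** * The seven faces of a half *)

Section HalfOctahedron.
Variables (R : realType) (c : 'rV[R]_3) (a b h : R).
Hypotheses (a0 : a != 0) (b0 : b != 0) (h0 : h != 0).

(** The coefficients of [x], [y], [z] in the seven inequalities, whose right-hand
sides are [half_level]. *)
Definition half_coef (i : 'I_7) : R * R * R :=
  nth (0, 0, 0) [:: (0, -1, 0); (1, 0, 1); (1, 0, -1); (-1, 0, 1);
                    (-1, 0, -1); (0, 1, 1); (0, 1, -1)] i.

Definition half_level (i : 'I_7) : R := nth 0 [:: 0; 1; 1; 1; 1; 1; 1] i.

Definition half_normal i : 'rV[R]_3 :=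
  vec3 ((half_coef i).1.1 / a) ((half_coef i).1.2 / b) ((half_coef i).2 / h).

Definition half_offset i : R := half_level i + dot (half_normal i) c.

Definition half_form i x y z : R :=
  (half_coef i).1.1 * x + (half_coef i).1.2 * y + (half_coef i).2 * z.

Lemma dot_half_normal i x y z :
  dot (half_normal i) (frame c a b h x y z) - dot (half_normal i) c =
  half_form i x y z.
Proof.
rewrite dotDr [in LHS]addrC addKr dot_vec3 /half_form.
by field; rewrite a0 b0 h0.
Qed.

Lemma half_polyhedron : bipyramid c a b h 0 = polyhedron half_normal half_offset.
Proof.
apply/predeqP => p; have [x [y [z ->]]] := frame_surj c a0 b0 h0 p.
have nx := ler_norm x; have nz := ler_norm z.
have := ler_norm (- x); have := ler_norm (- z); rewrite !normrN => nNz nNx.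
split=> [/bipyramidP[]// H1 H2 H3 i|H].
  rewrite -lerBlDr dot_half_normal //.
  by case: i => -[|[|[|[|[|[|[|//]]]]]]] ?; rewrite /half_form /half_level /=; lra.
have {}H i : half_form i x y z <= half_level i.
  by rewrite -dot_half_normal lerBlDr.
have H0 := H (inord 0); have H1 := H (inord 1); have H2 := H (inord 2).
have H3 := H (inord 3); have H4 := H (inord 4); have H5 := H (inord 5).
have H6 := H (inord 6).
rewrite /half_form /half_level /half_coef !inordK //= in H0 H1 H2 H3 H4 H5 H6.
apply/bipyramidP => //; split.
- by case: (ger0P x); case: (ger0P z); lra.
- by case: (ger0P z); lra.
- lra.
Qed.

(** Coordinates, in thirds, of a point in the relative interior of each face. *)
Definition facet_point (i : 'I_7) : 'rV[R]_3 :=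
  let p := nth (0, 0, 0)
    [:: (0, 0, 0); (2, 1, 1); (2, 1, -1); (-2, 1, 1); (-2, 1, -1);
        (0, 2, 1); (0, 2, -1)] i in
  frame c a b h (p.1.1 / 3) (p.1.2 / 3) (p.2 / 3).

Lemma half_normal_neq0 i : half_normal i != 0.
Proof.
apply/eqP => n0.
have := dot_half_normal i (half_coef i).1.1 (half_coef i).1.2 (half_coef i).2.
rewrite n0 /dot !big1 => [|? _|? _]; rewrite ?mxE ?mul0r // subrr /half_form.
by case: i {n0} => -[|[|[|[|[|[|[|//]]]]]]] ? /=; lra.
Qed.

Lemma half_normal_lt i x y z :
  (dot (half_normal i) (frame c a b h x y z) < half_offset i) =
  (half_form i x y z < half_level i).
Proof. by rewrite -ltrBlDr dot_half_normal. Qed.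

Lemma half_normal_eq i x y z :
  dot (half_normal i) (frame c a b h x y z) = half_offset i <->
  half_form i x y z = half_level i.
Proof.
rewrite -dot_half_normal /half_offset; split => [->|<-]; [exact: addrK|].
by rewrite subrK.
Qed.

Lemma facet_point_on i : dot (half_normal i) (facet_point i) = half_offset i.
Proof.
apply/half_normal_eq; rewrite /half_form /half_level.
by case: i => -[|[|[|[|[|[|[|//]]]]]]] ? /=; lra.
Qed.

Lemma facet_point_off i j : j != i ->
  dot (half_normal j) (facet_point i) < half_offset j.
Proof.
rewrite half_normal_lt /half_form /half_level.
case: i => -[|[|[|[|[|[|[|//]]]]]]] ?;
  by case: j => -[|[|[|[|[|[|[|//]]]]]]] ? //= _; lra.
Qed.

Lemma center_in i :
  dot (half_normal i) (frame c a b h 0 (1 / 2) 0) < half_offset i.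
Proof.
rewrite half_normal_lt /half_form /half_level.
by case: i => -[|[|[|[|[|[|[|//]]]]]]] ? /=; lra.
Qed.

Lemma half_heptahedron : heptahedron (bipyramid c a b h 0).
Proof.
split; first exact: bipyramid_polytope.
  by rewrite half_polyhedron; exact: (affine_dim_polyhedron center_in).
rewrite half_polyhedron.
exact: (card_facets half_normal_neq0 center_in facet_point_on facet_point_off).
Qed.

Lemma half_interior x y z :
  interior (bipyramid c a b h 0) (frame c a b h x y z) -> 0 < y.
Proof.
rewrite half_polyhedron (interior_polyhedron _ half_normal_neq0) => /(_ ord0).
by rewrite half_normal_lt /half_form /half_level /=; lra.
Qed.

Definition on_boundary (x y z : R) : Prop :=
  [/\ `|x| + `|z| <= 1, y + `|z| <= 1, 0 <= y &
      [\/ y = 0, `|x| + `|z| = 1 | y + `|z| = 1]].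

(** The four faces over the sides [x = 1] and [x = -1] of the base are merged into
[|x| + |z| = 1], and the two over [y = 1] into [y + |z| = 1]. *)
Lemma half_boundaryP x y z :
  boundary (bipyramid c a b h 0) (frame c a b h x y z) <-> on_boundary x y z.
Proof.
have bE : boundary (bipyramid c a b h 0) (frame c a b h x y z) <->
    in_bipyramid 0 x y z /\ exists i, half_form i x y z = half_level i.
  rewrite half_polyhedron (boundary_polyhedron _ half_normal_neq0).
  split=> [[i _ []]|[inP [i xi]]].
    rewrite -half_polyhedron => /bipyramidP inP /half_normal_eq xi.
    by split; [exact: inP|exists i].
  exists i => //; split; last exact/half_normal_eq.
  by rewrite -half_polyhedron; apply/bipyramidP.
apply: (iff_trans bE); rewrite /in_bipyramid /on_boundary mul0r.
split=> [[[H1 H2 H3] [i ip]]|[H1 H2 H3 H]].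
  split=> //; move: ip H1 H2; rewrite /half_form /half_level.
  case: i => [[|[|[|[|[|[|[|//]]]]]]] ?] /=.
  - move=> ? _ _; apply: Or31; lra.
  - case: (ger0P x); case: (ger0P z) => *; apply: Or32; lra.
  - case: (ger0P x); case: (ger0P z) => *; apply: Or32; lra.
  - case: (ger0P x); case: (ger0P z) => *; apply: Or32; lra.
  - case: (ger0P x); case: (ger0P z) => *; apply: Or32; lra.
  - case: (ger0P z) => *; apply: Or33; lra.
  - case: (ger0P z) => *; apply: Or33; lra.
split=> //; rewrite /half_form /half_level /half_coef.
case: H => [y0|xz|yz].
- by exists (inord 0); rewrite inordK //=; lra.
- move: xz; case: (ger0P x); case: (ger0P z) => ? ? ?.
  + by exists (inord 1); rewrite inordK //=; lra.
  + by exists (inord 2); rewrite inordK //=; lra.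
  + by exists (inord 3); rewrite inordK //=; lra.
  + by exists (inord 4); rewrite inordK //=; lra.
- move: yz; case: (ger0P z) => ? ?.
  + by exists (inord 5); rewrite inordK //=; lra.
  + by exists (inord 6); rewrite inordK //=; lra.
Qed.

(** * Orthogonal paths on the boundary of a half *)

Let path := orthogonal_path_in (boundary (bipyramid c a b h 0)).

Lemma conv_between (x1 x2 t : R) : x1 <= x2 -> 0 <= t <= 1 ->
  x1 <= (1 - t) * x1 + t * x2 <= x2.
Proof. nra. Qed.

Lemma path_x x1 x2 y z : x1 <= x2 ->
  (forall x, x1 <= x <= x2 -> on_boundary x y z) ->
  path (frame c a b h x1 y z) (frame c a b h x2 y z).
Proof.
move=> x12 bd; apply: (@orthogonal_path_edge _ _ _ _ _ x_axis (a * (x2 - x1))).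
  by apply/rowP => -[[|[|[|//]]] ?]; rewrite !mxE /=; ring.
move=> _ [t /= /[!in_itv]/= t01 <-]; rewrite frame_conv.
rewrite (_ : (1 - t) * y + t * y = y) 1?(_ : (1 - t) * z + t * z = z); try ring.
exact/half_boundaryP/bd/conv_between.
Qed.

Lemma path_y x y1 y2 z : y1 <= y2 ->
  (forall y, y1 <= y <= y2 -> on_boundary x y z) ->
  path (frame c a b h x y1 z) (frame c a b h x y2 z).
Proof.
move=> y12 bd; apply: (@orthogonal_path_edge _ _ _ _ _ y_axis (b * (y2 - y1))).
  by apply/rowP => -[[|[|[|//]]] ?]; rewrite !mxE /=; ring.
move=> _ [t /= /[!in_itv]/= t01 <-]; rewrite frame_conv.
rewrite (_ : (1 - t) * x + t * x = x) 1?(_ : (1 - t) * z + t * z = z); try ring.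
exact/half_boundaryP/bd/conv_between.
Qed.

Lemma path_z x y z1 z2 : z1 <= z2 ->
  (forall z, z1 <= z <= z2 -> on_boundary x y z) ->
  path (frame c a b h x y z1) (frame c a b h x y z2).
Proof.
move=> z12 bd; apply: (@orthogonal_path_edge _ _ _ _ _ z_axis (h * (z2 - z1))).
  by apply/rowP => -[[|[|[|//]]] ?]; rewrite !mxE /=; ring.
move=> _ [t /= /[!in_itv]/= t01 <-]; rewrite frame_conv.
rewrite (_ : (1 - t) * x + t * x = x) 1?(_ : (1 - t) * y + t * y = y); try ring.
exact/half_boundaryP/bd/conv_between.
Qed.

(** First to height [0], then along the x-axis: neither increases [|x| + |z|]. *)
Lemma section_path x z : `|x| + `|z| <= 1 ->
  path (frame c a b h x 0 z) (frame c a b h 0 0 0).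
Proof.
move=> xz; apply: (@orthogonal_path_trans _ _ _ _ (frame c a b h x 0 0)).
  have bd z' : `|z'| <= `|z| -> on_boundary x 0 z'.
    move=> zz'; have := normr_ge0 x; have := normr_ge0 z'; move=> *.
    by split; [lra|lra|lra|exact: Or31].
  have [z0|z0] := ger0P z.
    apply/orthogonal_path_sym/path_z => // z' /andP[z'0 z'z].
    by apply: bd; rewrite !ger0_norm.
  apply: path_z => [|z' /andP[zz' z'0]]; first exact: ltW.
  by apply: bd; rewrite !ler0_norm ?lerN2 // ltW.
have bd x' : `|x'| <= `|x| -> on_boundary x' 0 0.
  move=> xx'; have := normr_ge0 x'; have := normr_ge0 z; move=> *.
  by split; rewrite ?normr0; [lra|lra|lra|exact: Or31].
have [x0|x0] := ger0P x.
  apply/orthogonal_path_sym/path_x => // x' /andP[x'0 x'x].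
  by apply: bd; rewrite !ger0_norm.
apply: path_x => [|x' /andP[xx' x'0]]; first exact: ltW.
by apply: bd; rewrite !ler0_norm ?lerN2 // ltW.
Qed.

(** The face is parallel to the y-axis, along which it reaches the section. *)
Lemma side_path x y z : `|x| + `|z| = 1 -> 0 <= y -> y + `|z| <= 1 ->
  path (frame c a b h x y z) (frame c a b h 0 0 0).
Proof.
move=> xz y0 yz; apply: (@orthogonal_path_trans _ _ _ _ (frame c a b h x 0 z)).
  apply/orthogonal_path_sym/path_y => // y' /andP[y'0 y'y].
  by split; [lra|lra|lra|exact: Or32].
by apply: section_path; rewrite xz.
Qed.

(** The face is parallel to the x-axis; at [x = y] it meets the face
[|x| + |z| = 1]. *)
Lemma front_path x y z : y + `|z| = 1 -> 0 <= y -> `|x| + `|z| <= 1 ->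
  path (frame c a b h x y z) (frame c a b h 0 0 0).
Proof.
move=> yz y0 xz.
apply: (@orthogonal_path_trans _ _ _ _ (frame c a b h y y z)); last first.
  by apply: side_path; rewrite ?yz // ger0_norm.
have xy : x <= y by have := ler_norm x; lra.
apply: path_x => // x' /andP[xx' x'y]; split; [|lra|lra|exact: Or33].
have : `|x'| <= y; last by lra.
by rewrite ler_norml x'y andbT; have := ler_norm (- x); rewrite normrN; lra.
Qed.

Lemma half_connected :
  orthogonally_connected (boundary (bipyramid c a b h 0)).
Proof.
have to_center p : boundary (bipyramid c a b h 0) p ->
    path p (frame c a b h 0 0 0).
  have [x [y [z ->]]] := frame_surj c a0 b0 h0 p.
  move=> /half_boundaryP[xz yz y0 [y00|xz1|yz1]].
  - by rewrite y00; exact: section_path.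
  - exact: side_path.
  - exact: front_path.
move=> p q /to_center p0 /to_center /orthogonal_path_sym q0 _.
exact: orthogonal_path_trans p0 q0.
Qed.
End HalfOctahedron.

(** * The octahedron and its two halves *)

Lemma frameN (R : realType) (c : 'rV[R]_3) (a b h x y z : R) :
  frame c a (- b) h x y z = frame c a b h x (- y) z.
Proof. by rewrite /frame mulNr mulrN. Qed.

Lemma bipyramid_split (R : realType) (c : 'rV[R]_3) (a b h : R) :
  a != 0 -> b != 0 -> h != 0 ->
  bipyramid c a b h (-1) = bipyramid c a b h 0 `|` bipyramid c a (- b) h 0.
Proof.
move=> a0 b0 h0; have bN0 : - b != 0 by rewrite oppr_eq0.
apply/predeqP => p; have [x [y [z ->]]] := frame_surj c a0 b0 h0 p.
have fE : frame c a b h x y z = frame c a (- b) h x (- y) z.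
  by rewrite frameN opprK.
split=> [/bipyramidP[]// H1 H2 H3|].
  have [y0|y0] := leP 0 y; [left|right; rewrite fE];
    by apply/bipyramidP => //; split; lra.
case; [|rewrite fE] => /bipyramidP[]// H1 H2 H3; rewrite -?fE.
  by apply/bipyramidP => //; split => //; lra.
by apply/bipyramidP => //; split => //; lra.
Qed.

Lemma bipyramid_decomposed (R : realType) (c : 'rV[R]_3) (a b h : R) :
  a != 0 -> b != 0 -> h != 0 ->
  decomposed_into (bipyramid c a b h (-1))
    (fun i : 'I_2 => bipyramid c a (if i == 0 then b else - b) h 0).
Proof.
move=> a0 b0 h0; have bN0 : - b != 0 by rewrite oppr_eq0.
split.
  rewrite bipyramid_split //; apply/seteqP; split=> [p [|]|p [i _]].
  - by exists 0.
  - by exists 1.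
  - by case: ifP => _; [left|right].
have disj : (bipyramid c a b h 0)° `&` (bipyramid c a (- b) h 0)° = set0.
  apply/seteqP; split => // p; have [x [y [z ->]]] := frame_surj c a0 b0 h0 p.
  move=> [/half_interior y0]; rewrite -[y in frame _ _ _ _ _ y _]opprK -frameN.
  by move=> /half_interior yN0; have := y0 a0 b0 h0; have := yN0 a0 bN0 h0; lra.
move=> [[|[|//]] ?] [[|[|//]] ?] //= _.
by rewrite setIC; exact: disj.
Qed.

Lemma parallel_axes_perp (R : realType) (i j : 'I_3) (u v : 'rV[R]_3) :
  parallel_to_axis i u -> parallel_to_axis j v -> dot u v = 0 -> i != j.
Proof.
move=> [s s0 ->] [t t0 ->]; apply: contra_eqN => /eqP->.
rewrite dotZl dotZr !mulf_neq0 // gt_eqF // dot_gt0 //.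
by apply/eqP => /rowP/(_ j)/eqP; rewrite !mxE !eqxx oner_eq0.
Qed.

(** With [a] and [b] half the signed lengths of the sides [u - v] and [u + v], the
points [c + u] and [c + v] get the coordinates [(1, 1, 0)] and [(-1, 1, 0)]. *)
Lemma octahedron_bipyramid (R : realType) (c u v w : 'rV[R]_3) :
  parallel_to_axis x_axis (u - v) -> parallel_to_axis y_axis (u + v) ->
  parallel_to_axis z_axis w ->
  exists a b h, [/\ a != 0, b != 0, h != 0 &
    Defs.conv [set c + u; c - u; c + v; c - v; c + w; c - w] =
    bipyramid c a b h (-1)].
Proof.
move=> [s s0 uv] [t t0 vu] [h h0 wE].
have half0 x : x != 0 -> x / 2 != 0 :> R.
  by move=> x0; rewrite mulf_neq0 // invr_neq0 // pnatr_eq0.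
exists (s / 2), (t / 2), h; split; [exact: half0|exact: half0|exact: h0|].
have [a0 b0] := (half0 _ s0, half0 _ t0).
rewrite (conv_bipyramid c a0 b0 h0); last by lra.
have frameE x y z : frame c (s / 2) (t / 2) h x y z =
    c + ((x + y) / 2) *: u + ((y - x) / 2) *: v + z *: w.
  transitivity (c + (x / 2) *: (u - v) + (y / 2) *: (u + v) + z *: w).
    rewrite uv vu wE.
    by apply/rowP => -[[|[|[|//]]] ?]; rewrite !mxE /=; field.
  by apply/rowP => k; rewrite !mxE; field.
have vertexE x y z p : c + ((x + y) / 2) *: u + ((y - x) / 2) *: v + z *: w = p ->
    frame c (s / 2) (t / 2) h x y z = p by rewrite frameE.
rewrite /bipyramid_vertices.
rewrite (vertexE 1 (-1) 0 (c - v)); last first.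
  by apply/rowP => k; rewrite !mxE; field.
rewrite (vertexE (-1) (-1) 0 (c - u)); last first.
  by apply/rowP => k; rewrite !mxE; field.
rewrite (vertexE 1 1 0 (c + u)); last first.
  by apply/rowP => k; rewrite !mxE; field.
rewrite (vertexE (-1) 1 0 (c + v)); last first.
  by apply/rowP => k; rewrite !mxE; field.
rewrite (vertexE 0 0 1 (c + w)); last first.
  by apply/rowP => k; rewrite !mxE; field.
rewrite (vertexE 0 0 (-1) (c - w)); last first.
  by apply/rowP => k; rewrite !mxE; field.
by congr (Defs.conv _); apply/predeqP => p /=; tauto.
Qed.

(** The sides [u - v] and [u + v] are nonzero and orthogonal, so they are parallel
to different axes.  Replacing [v] by [- v] exchanges them, so the first may be
assumed parallel to the x-axis. *)
Lemma standard_octahedron_bipyramid (R : realType) (O : set 'rV[R]_3) :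
  standard_octahedron O ->
  exists c a b h,
    [/\ a != 0, b != 0, h != 0 & O = bipyramid c a b h (-1)].
Proof.
move=> [c [u [v [w [[[uv _ _] [uu _] _ ->] wz pm pp]]]]]; exists c.
have perp : dot (u - v) (u + v) = 0.
  by rewrite dotDr ![dot (u - v) _]dotC !dotBr (dotC v u) uv uu; ring.
case: pm pp => [] pm [] pp.
- by have := parallel_axes_perp pm pp perp; rewrite eqxx.
- have [a [b [h [a0 b0 h0 E]]]] := octahedron_bipyramid c pm pp wz.
  by exists a, b, h.
- rewrite -[v]opprK in pp.
  have [a [b [h [a0 b0 h0 E]]]] := octahedron_bipyramid c pp pm wz.
  exists a, b, h; split=> //; rewrite -E opprK.
  by congr (Defs.conv _); apply/predeqP => p /=; tauto.
- by have := parallel_axes_perp pm pp perp; rewrite eqxx.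
Qed.

Theorem theorem4p2 (R : realType) (O : set 'rV[R]_3)
    (hO : standard_octahedron O) :
  exists Q : 'I_2 -> set 'rV[R]_3,
    decomposed_into O Q /\
    forall i, heptahedron (Q i) /\ orthogonally_connected (boundary (Q i)).
Proof.
have [c [a [b [h [a0 b0 h0 ->]]]]] := standard_octahedron_bipyramid hO.
exists (fun i => bipyramid c a (if i == 0 then b else - b) h 0).
split; first exact: bipyramid_decomposed.
move=> i; have bi : (if i == 0 then b else - b) != 0.
  by case: ifP; rewrite ?oppr_eq0.
by split; [exact: half_heptahedron|exact: half_connected].
Qed.
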